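(* Let $L,M,N$ be positive integers and let $g:=\{g_l\}_{l\in\mathbb{N}_L}\subset\ell^2(\mathbb{Z}\times\mathbb{Z},\mathbb{H})$. If $\mathcal{G}(g,L,M,N)$ is a Gabor frame for $\ell^2(\mathbb{Z}\times\mathbb{Z},\mathbb{H})$ with frame bounds $A\le B$, then for all $k\in\mathbb{Z}^2$, $$\frac{A}{M^2}\le\sum_{l\in\mathbb{N}_L}\left(\mathcal{M}_{g_l}(k)\mathcal{M}_{g_l}^*(k)\right)_{0_{\mathbb{Z}^2},0_{\mathbb{Z}^2}}\le\frac{B}{M^2}.$$
   Context: $\mathbb{H}$ is the algebra of real quaternions with imaginary units $i,j,ij$. For a positive integer $K$, $\mathbb{N}_K:=\{0,1,\dots,K-1\}$. $\ell^2(\mathbb{Z}\times\mathbb{Z},\mathbb{H})$ is the right quaternionic Hilbert space of functions $f:\mathbb{Z}^2\to\mathbb{H}$ with $\sum_{k\in\mathbb{Z}^2}|f(k)|^2<\infty$, with inner product $\langle f,g\rangle=\sum_{k\in\mathbb{Z}^2}\overline{f(k)}\,g(k)$. For $n\in\mathbb{Z}^2$, $(T_{nN}f)(k)=f(k-nN)$ where $nN=(n_1N,n_2N)$. For $m=(m_1,m_2)\in\mathbb{N}_M^2$, $(E_{\frac mM}f)(k)=e^{2\pi i\frac{m_1}{M}k_1}f(k)e^{2\pi j\frac{m_2}{M}k_2}$, $k=(k_1,k_2)\in\mathbb{Z}^2$. The Gabor system is $\mathcal{G}(g,L,M,N):=\{E_{\frac mM}T_{nN}g_l\}_{l\in\mathbb{N}_L,\,m\in\mathbb{N}_M^2,\,n\in\mathbb{Z}^2}$.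 It is a frame with frame bounds $A\le B$ (where $0<A\le B<\infty$) if for all $h\in\ell^2(\mathbb{Z}\times\mathbb{Z},\mathbb{H})$: $A\|h\|^2\le\sum_{l\in\mathbb{N}_L}\sum_{n\in\mathbb{Z}^2}\sum_{m\in\mathbb{N}_M^2}|\langle E_{\frac mM}T_{nN}g_l,h\rangle|^2\le B\|h\|^2$. For $h\in\ell^2(\mathbb{Z}\times\mathbb{Z},\mathbb{H})$ and $k\in\mathbb{Z}^2$, $\mathcal{M}_h(k)$ is the matrix indexed by $\mathbb{Z}^2\times\mathbb{Z}^2$ with entries $(\mathcal{M}_h(k))_{p,n}=h(k+pM-nN)$, $p,n\in\mathbb{Z}^2$; $^*$ denotes conjugate transpose, so $(\mathcal{M}_{h}(k)\mathcal{M}_{h}^*(k))_{m,p}=\sum_{n\in\mathbb{Z}^2}h(k+mM-nN)\overline{h(k+pM-nN)}$. $0_{\mathbb{Z}^2}=(0,0)$. *)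

(* Defs.v *)
From HB Require Import structures.
From mathcomp Require Import all_boot all_order all_algebra.
From mathcomp Require Import ring lra.
From mathcomp Require Import all_classical all_reals all_analysis.
From mathcomp.analysis.showcase Require summability.

Set Implicit Arguments.
Unset Strict Implicit.
Unset Printing Implicit Defensive.

Import Order.TTheory GRing.Theory Num.Theory.
Import numFieldNormedType.Exports.

Local Open Scope ring_scope.
Local Open Scope classical_set_scope.

(* [Quat a b c d] is a + b i + c j + d ij. *)
Record quat (R : Type) : Type :=
  Quat { qre : R; qim_i : R; qim_j : R; qim_ij : R }.

Section QuatStructures.
Variable R : realType.
Local Notation H := (quat R).

Definition quat_to_tuple (q : H) := (qre q, qim_i q, qim_j q, qim_ij q).
Definition quat_of_tuple (t : R * R * R * R) : H :=
  let: (a, b, c, d) := t in Quat a b c d.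

Lemma quat_to_tupleK : cancel quat_to_tuple quat_of_tuple.
Proof. by case. Qed.

HB.instance Definition _ := Choice.copy H (can_type quat_to_tupleK).

Definition quat_add (p q : H) : H :=
  Quat (qre p + qre q) (qim_i p + qim_i q)
       (qim_j p + qim_j q) (qim_ij p + qim_ij q).

Definition quat_opp (p : H) : H :=
  Quat (- qre p) (- qim_i p) (- qim_j p) (- qim_ij p).

Lemma quat_addA : associative quat_add.
Proof. by move=> p q r; rewrite /quat_add /=; congr Quat; ring. Qed.

Lemma quat_addC : commutative quat_add.
Proof. by move=> p q; rewrite /quat_add /=; congr Quat; ring. Qed.

Lemma quat_add0 : left_id (Quat 0 0 0 0) quat_add.
Proof. by case=> a b c d; rewrite /quat_add /=; congr Quat; ring. Qed.

Lemma quat_addN : left_inverse (Quat 0 0 0 0) quat_opp quat_add.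
Proof. by move=> p; rewrite /quat_add /=; congr Quat; ring. Qed.

HB.instance Definition _ :=
  GRing.isZmodule.Build H quat_addA quat_addC quat_add0 quat_addN.

Definition quat_mul (p q : H) : H :=
  let: Quat a1 b1 c1 d1 := p in
  let: Quat a2 b2 c2 d2 := q in
  Quat (a1 * a2 - b1 * b2 - c1 * c2 - d1 * d2)
       (a1 * b2 + b1 * a2 + c1 * d2 - d1 * c2)
       (a1 * c2 - b1 * d2 + c1 * a2 + d1 * b2)
       (a1 * d2 + b1 * c2 - c1 * b2 + d1 * a2).

Lemma quat_mulA : associative quat_mul.
Proof.
by case=> a b c d [a' b' c' d'] [x y z t]; rewrite /quat_mul; congr Quat; ring.
Qed.

Lemma quat_mul1q : left_id (Quat 1 0 0 0) quat_mul.
Proof. by case=> a b c d; rewrite /quat_mul; congr Quat; ring. Qed.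

Lemma quat_mulq1 : right_id (Quat 1 0 0 0) quat_mul.
Proof. by case=> a b c d; rewrite /quat_mul; congr Quat; ring. Qed.

Lemma quat_mulDl : left_distributive quat_mul quat_add.
Proof.
by case=> a b c d [a' b' c' d'] [x y z t];
  rewrite /quat_mul /quat_add /=; congr Quat; ring.
Qed.

Lemma quat_mulDr : right_distributive quat_mul quat_add.
Proof.
by case=> a b c d [a' b' c' d'] [x y z t];
  rewrite /quat_mul /quat_add /=; congr Quat; ring.
Qed.

Lemma quat_1neq0 : Quat 1 0 0 0 != 0 :> H.
Proof. by apply/eqP => -[] /eqP; rewrite oner_eq0. Qed.

HB.instance Definition _ :=
  GRing.Zmodule_isNzRing.Build H quat_mulA quat_mul1q quat_mulq1
    quat_mulDl quat_mulDr quat_1neq0.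

Definition quat_scale (a : R) (p : H) : H :=
  Quat (a * qre p) (a * qim_i p) (a * qim_j p) (a * qim_ij p).

Lemma quat_scaleA a b p : quat_scale a (quat_scale b p) = quat_scale (a * b) p.
Proof. by rewrite /quat_scale /=; congr Quat; ring. Qed.

Lemma quat_scale1 : left_id 1 quat_scale.
Proof. by case=> a b c d; rewrite /quat_scale /=; congr Quat; ring. Qed.

Lemma quat_scaleDr : right_distributive quat_scale +%R.
Proof.
by move=> a p q; rewrite [LHS]/quat_scale /=; congr Quat; rewrite /=; ring.
Qed.

Lemma quat_scaleDl p : {morph quat_scale^~ p : a b / a + b}.
Proof.
by move=> a b; rewrite [LHS]/quat_scale /=; congr Quat; rewrite /=; ring.
Qed.

HB.instance Definition _ := GRing.Zmodule_isLmodule.Build R H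
  quat_scaleA quat_scale1 quat_scaleDr quat_scaleDl.

Lemma quat_scaleAl (a : R) (p q : H) : a *: (p * q) = (a *: p) * q.
Proof.
case: p q => [a1 b1 c1 d1] [a2 b2 c2 d2].
rewrite /GRing.scale /GRing.mul /= /quat_scale /=.
by congr Quat; ring.
Qed.

HB.instance Definition _ := GRing.Lmodule_isLalgebra.Build R H quat_scaleAl.

Definition quat_norm (p : H) : R :=
  Num.sqrt (qre p ^+ 2 + qim_i p ^+ 2 + qim_j p ^+ 2 + qim_ij p ^+ 2).

Lemma quat_norm_triangle (p q : H) :
  quat_norm (p + q) <= quat_norm p + quat_norm q.
Proof.
case: p q => [a1 b1 c1 d1] [a2 b2 c2 d2]; rewrite /quat_norm /=.
set s := a1 ^+ 2 + _ + _ + _; set t := a2 ^+ 2 + _ + _ + _.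
have s0 : 0 <= s by rewrite /s; do !apply: addr_ge0; exact: sqr_ge0.
have t0 : 0 <= t by rewrite /t; do !apply: addr_ge0; exact: sqr_ge0.
pose u := a1 * a2 + b1 * b2 + c1 * c2 + d1 * d2.
have ust : u <= Num.sqrt s * Num.sqrt t.
  rewrite -sqrtrM// (le_trans (ler_norm u))// -sqrtr_sqr ler_wsqrtr//.
  rewrite -subr_ge0 [leRHS](_ : _ = (a1 * b2 - b1 * a2) ^+ 2 +
    (a1 * c2 - c1 * a2) ^+ 2 + (a1 * d2 - d1 * a2) ^+ 2 +
    (b1 * c2 - c1 * b2) ^+ 2 + (b1 * d2 - d1 * b2) ^+ 2 +
    (c1 * d2 - d1 * c2) ^+ 2); last by rewrite /s /t /u; ring.
  by do !apply: addr_ge0; exact: sqr_ge0.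
have st0 : 0 <= Num.sqrt s + Num.sqrt t by rewrite addr_ge0// sqrtr_ge0.
rewrite -(ger0_norm st0) -sqrtr_sqr ler_wsqrtr// [leRHS]sqrrD !sqr_sqrtr//.
apply: (@le_trans _ _ (s + u *+ 2 + t)).
  by rewrite le_eqVlt /s /t /u; apply/orP; left; apply/eqP; ring.
by rewrite lerD2r lerD2l lerMn2r ust orbT.
Qed.

Lemma quat_normZ (l : R) (p : H) : quat_norm (l *: p) = `|l| * quat_norm p.
Proof.
rewrite /quat_norm /= !exprMn -!mulrDr sqrtrM ?sqr_ge0//.
by rewrite sqrtr_sqr.
Qed.

Lemma quat_norm0_eq0 (p : H) : quat_norm p = 0 -> p = 0.
Proof.
case: p => a b c d; rewrite /quat_norm /= => /eqP; rewrite sqrtr_eq0 => le0.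
have [a2 b2 c2 d2] : [/\ 0 <= a ^+ 2, 0 <= b ^+ 2, 0 <= c ^+ 2 & 0 <= d ^+ 2].
  by split; exact: sqr_ge0.
by congr Quat; apply/eqP; rewrite -sqrf_eq0 eq_le; apply/andP; split=> //; lra.
Qed.

HB.instance Definition _ :=
  Lmodule_isNormed.Build R H quat_norm_triangle quat_normZ quat_norm0_eq0.

End QuatStructures.

Definition qconj (R : realType) (q : quat R) : quat R :=
  Quat (qre q) (- qim_i q) (- qim_j q) (- qim_ij q).

Definition qi {R : realType} : quat R := Quat 0 1 0 0.
Definition qj {R : realType} : quat R := Quat 0 0 1 0.

(* For an imaginary unit u (u^2 = -1, so that R + R u is a copy of the complex
   numbers) and a real t, this is e^{u t}, by Euler's formula. *)
Definition qcis (R : realType) (u : quat R) (t : R) : quat R :=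
  (cos t)%:A + sin t *: u.

Notation Z2 := (int * int)%type.

(* Unconditional sum over Z x Z: the limit of the finite partial sums along the
   directed set of finite subsets, in the norm topology of the quaternions. The
   series it is applied to below, for functions in l^2, converge absolutely. *)
Definition Z2sum (R : realType) (x : Z2 -> quat R) : quat R :=
  summability.sum x.

Definition norm2sq (R : realType) (f : Z2 -> quat R) : \bar R :=
  \esum_(k in [set: Z2]) (`|f k| ^+ 2)%:E.

Definition ell2 (R : realType) : set (Z2 -> quat R) :=
  [set f | (norm2sq f < +oo)%E].

(* Right-linear in the second argument: <f, g q> = <f, g> q. *)
Definition inner (R : realType) (f g : Z2 -> quat R) : quat R :=
  Z2sum (fun k => qconj (f k) * g k).

(* On Z x Z, [n *+ N] is the componentwise multiple (n_1 N, n_2 N). *)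
Definition translation (R : realType) (N : nat) (n : Z2) (f : Z2 -> quat R) :
    Z2 -> quat R :=
  fun k => f (k - n *+ N).

Definition modulation (R : realType) (M : nat) (m : 'I_M * 'I_M)
    (f : Z2 -> quat R) : Z2 -> quat R :=
  fun k =>
    qcis qi (2 * pi * (m.1%:R / M%:R) * k.1%:~R) * f k *
    qcis qj (2 * pi * (m.2%:R / M%:R) * k.2%:~R).

Definition gabor (R : realType) (L M N : nat) (g : 'I_L -> Z2 -> quat R)
    (l : 'I_L) (m : 'I_M * 'I_M) (n : Z2) : Z2 -> quat R :=
  modulation m (translation N n (g l)).

Definition gabor_frame (R : realType) (L M N : nat) (g : 'I_L -> Z2 -> quat R)
    (A B : R) : Prop :=
  0 < A <= B /\
  forall h : Z2 -> quat R, ell2 h ->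
    let S := (\sum_(l < L) \esum_(n in [set: Z2])
                \sum_(m : 'I_M * 'I_M)
                  (`|inner (@gabor R L M N g l m n) h| ^+ 2)%:E)%E in
    (A%:E * norm2sq h <= S)%E /\ (S <= B%:E * norm2sq h)%E.

Definition Z2matrix (R : realType) := Z2 -> Z2 -> quat R.

Definition Z2mulmx (R : realType) (X Y : Z2matrix R) : Z2matrix R :=
  fun m p => Z2sum (fun n => X m n * Y n p).

Definition Z2adjmx (R : realType) (X : Z2matrix R) : Z2matrix R :=
  fun n p => qconj (X p n).

Definition calM (R : realType) (M N : nat) (h : Z2 -> quat R) (k : Z2) :
    Z2matrix R :=
  fun p n => h (k + p *+ M - n *+ N).

(* Main.v *)
(* Test the frame inequality on the point mass at k: its norm is 1, and since
   modulations are unimodular, each of the M^2 modulations m contributes the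
   same |g_l(k - nN)|^2. *)
Require Import Defs.
From mathcomp Require Import all_boot all_order all_algebra.
From mathcomp Require Import all_classical all_reals all_analysis.
From mathcomp Require Import finmap ring lra.
From mathcomp.analysis.showcase Require summability.

Import Order.TTheory GRing.Theory Num.Theory.
Import numFieldNormedType.Exports.

Local Open Scope ring_scope.

(** Tested on the point mass at [k], the frame inequality becomes A <= M^2 s <= B, where s is the
    sum over l and n of |g_l(k - nN)|^2: by [Z2sum_supp1] only one term of each inner product
    survives, and [normsq_gabor] removes the modulation from its modulus. Since q times its
    conjugate is |q|^2, s is also the sum of the diagonal entries. These are limits of quaternionic
    sums, while the frame bounds speak of extended real sums; [Z2sum_alg] reconciles the two. *)

Section Quaternions.
Context {R : realType}.
Implicit Types p q : quat R.

Lemma quat_normE p :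
  `|p| = Num.sqrt (qre p ^+ 2 + qim_i p ^+ 2 + qim_j p ^+ 2 + qim_ij p ^+ 2).
Proof. by []. Qed.

Lemma quat_normsqE p :
  `|p| ^+ 2 = qre p ^+ 2 + qim_i p ^+ 2 + qim_j p ^+ 2 + qim_ij p ^+ 2.
Proof. by rewrite quat_normE sqr_sqrtr// !addr_ge0 ?sqr_ge0. Qed.

(** This is Euler's four-square identity. *)
Lemma quat_normsqM p q : `|p * q| ^+ 2 = `|p| ^+ 2 * `|q| ^+ 2.
Proof.
by rewrite !quat_normsqE; case: p q => [a b c d] [x y z t] /=; ring.
Qed.

Lemma quat_normsq_qconj p : `|qconj p| ^+ 2 = `|p| ^+ 2.
Proof. by rewrite !quat_normsqE /= !sqrrN. Qed.

Lemma quat_mul_qconj p : p * qconj p = (`|p| ^+ 2)%:A.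
Proof.
rewrite quat_normsqE; case: p => a b c d.
by rewrite /GRing.scale /GRing.mul /GRing.one /= /quat_scale /=; congr Quat; ring.
Qed.

Lemma quat_norm_alg (a : R) : `|a%:A : quat R| = `|a|.
Proof.
by rewrite normrZ quat_normE /= expr1n expr0n /= !addr0 sqrtr1 mulr1.
Qed.

Lemma quat_normsq_qcis_qi (t : R) : `|qcis qi t| ^+ 2 = 1.
Proof. by rewrite quat_normsqE /= !(mulr0, mulr1, add0r, addr0, expr0n) cos2Dsin2. Qed.

Lemma quat_normsq_qcis_qj (t : R) : `|qcis qj t| ^+ 2 = 1.
Proof. by rewrite quat_normsqE /= !(mulr0, mulr1, add0r, addr0, expr0n) cos2Dsin2. Qed.

Lemma normsq_gabor (L M N : nat) (g : 'I_L -> Z2 -> quat R) l m n k :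
  `|@gabor R L M N g l m n k| ^+ 2 = `|g l (k - n *+ N)| ^+ 2.
Proof.
by rewrite !quat_normsqM quat_normsq_qcis_qi quat_normsq_qcis_qj mul1r mulr1.
Qed.

End Quaternions.

Section Z2sum.
Local Open Scope classical_set_scope.
Context {R : realType}.

Lemma partial_sumE (I : choiceType) (V : zmodType) (x : I -> V) (A : {fset I}) :
  summability.partial_sum x A = \sum_(n <- A) x n.
Proof. by rewrite big_seq_fsetE. Qed.

Lemma Z2sum_cvg (x : Z2 -> quat R) (s : quat R) :
  summability.partial_sum x @ summability.totally --> s -> Z2sum x = s.
Proof.
have := @summability.totally_filter Z2.
by move=> ?; apply: cvg_lim; exact: norm_hausdorff.
Qed.

(** Partial sums are constant along the finite sets that contain [k]. *)
Lemma Z2sum_supp1 (x : Z2 -> quat R) k :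
  (forall n, n != k -> x n = 0) -> Z2sum x = x k.
Proof.
move=> x0; apply: Z2sum_cvg; have := @summability.totally_filter Z2 => F.
apply: cvg_near_cst; exists [fset k]%fset => //= A kA.
apply/eqP; rewrite partial_sumE (big_fsetD1 k)/=.
  rewrite big1_fset ?addr0// => n /[!inE] /andP[nk _] _; exact: x0.
by apply: (fsubsetP kA); rewrite inE.
Qed.

(** The extended sum is a supremum of finite sums, so some finite [X] already gives more than
    [s - e]; by nonnegativity every finite set containing [X] has its sum between [s - e] and
    [s]. *)
Lemma Z2sum_alg (a : Z2 -> R) (s : R) : (forall n, 0 <= a n) ->
  (\esum_(n in [set: Z2]) (a n)%:E = s%:E)%E ->
  Z2sum (fun n => (a n)%:A) = s%:A :> quat R.
Proof.
move=> a0 sum_a; apply: Z2sum_cvg; have := @summability.totally_filter Z2 => F.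
apply/cvgrPdist_le => e e0.
have : ((s - e)%:E < \esum_(n in [set: Z2]) (a n)%:E)%E.
  by rewrite sum_a lte_fin ltrBlDr ltrDl.
move=> /ereal_sup_gt[_ [X [finX _]] <-].
rewrite fsbig_finite// sumEFin lte_fin => seX.
exists (fset_set X) => //= A XA.
rewrite partial_sumE -scaler_suml -scalerBl quat_norm_alg.
have XleA : \sum_(n <- fset_set X) a n <= \sum_(n <- A) a n.
  rewrite (big_fsetID _ (mem (fset_set X)) A)/=.
  rewrite (_ : [fset n | n in A & n \in fset_set X]%fset = fset_set X).
    by rewrite lerDl sumr_ge0.
  apply/fsetP => n; rewrite !inE/=; apply/andP/idP => [[]//|nX].
  by split => //; exact: (fsubsetP XA).
have Ales : \sum_(n <- A) a n <= s.
  rewrite -lee_fin -sum_a; apply: ereal_sup_ubound; exists [set` A].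
    by split => //; exact: finite_fset.
  by rewrite fsbig_finite//= set_fsetK sumEFin.
rewrite ger0_norm ?subr_ge0//; lra.
Qed.

End Z2sum.

Theorem proposition2 (R : realType) (L M N : nat)
  (hL : (0 < L)%N) (hM : (0 < M)%N) (hN : (0 < N)%N)
  (g : 'I_L -> Z2 -> quat R) (hg : forall l : 'I_L, ell2 (g l))
  (A B : R) (hframe : gabor_frame M N g A B) (k : Z2) :
  exists s : R,
    \sum_(l < L)
       Z2mulmx (calM M N (g l) k) (Z2adjmx (calM M N (g l) k)) (0, 0) (0, 0)
      = s%:A
    /\ A / M%:R ^+ 2 <= s <= B / M%:R ^+ 2.
Proof.
case: hframe => _ frame.
pose h (n : Z2) : quat R := if n == k then 1 else 0.
have norm_h : norm2sq h = 1%:E.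
  rewrite /norm2sq -(@esum_set1 R Z2 k (fun=> 1%:E)) ?lee_fin// [RHS]esum_mkcond.
  apply: eq_esum => n _; rewrite /h in_set1.
  by case: eqP => _; rewrite quat_normsqE /= ?expr1n expr0n /= !addr0.
have := frame h; rewrite /ell2 /= norm_h !mule1 ltry => /(_ isT).
pose T l := (\esum_(n in [set: Z2]) (`|g l (k - n *+ N)| ^+ 2)%:E)%E.
have T0 l : (0 <= T l)%E.
  by apply: esum_ge0 => n _; rewrite lee_fin exprn_ge0.
have -> : (\sum_(l < L) \esum_(n in [set: Z2])
    \sum_(m : 'I_M * 'I_M) (`|inner (@gabor R L M N g l m n) h| ^+ 2)%:E)%E
    = (\sum_(l < L) \sum_(m : 'I_M * 'I_M) T l)%E.
  apply: eq_bigr => l _.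
  rewrite -esum_sum; last by move=> n m _ _; rewrite lee_fin exprn_ge0.
  apply: eq_esum => n _; apply: eq_bigr => m _; congr EFin.
  rewrite /inner (@Z2sum_supp1 _ _ k).
    by rewrite /h eqxx mulr1 quat_normsq_qconj normsq_gabor.
  by move=> p /negbTE pk; rewrite /h pk mulr0.
move=> [AS SB].
(* [T l] is at most the whole frame sum, hence at most [B]: it is the term of that sum at [l] and
   the modulation (0, 0), an index that exists because M > 0. *)
have Tfin l : T l \is a fin_num.
  rewrite ge0_fin_numE// (le_lt_trans _ (ltry B))// (le_trans _ SB)//.
  rewrite (bigD1 l)//= (bigD1 (Ordinal hM, Ordinal hM))//=.
  by rewrite -addeA leeDl// adde_ge0// ?sume_ge0// => *; rewrite sume_ge0.
exists (\sum_(l < L) fine (T l)); split.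
  rewrite scaler_suml; apply: eq_bigr => l _.
  rewrite /Z2mulmx -(@Z2sum_alg _ (fun n => `|g l (k - n *+ N)| ^+ 2)).
  - congr Z2sum; apply/funext => n; rewrite /calM /Z2adjmx.
    (* Reading the pair as the zero of the group turns k + 0 M - nN into k - nN. *)
    by rewrite -[(0, 0)]/(0 : Z2) mul0rn addr0 quat_mul_qconj.
  - by move=> n; rewrite exprn_ge0.
  - by rewrite fineK// Tfin.
(* The summand does not depend on m, so summing over modulations yields the factor M^2. *)
have S_eq : (\sum_(l < L) \sum_(m : 'I_M * 'I_M) T l)%E
    = ((\sum_(l < L) fine (T l)) * M%:R ^+ 2)%:E.
  rewrite mulr_suml -sumEFin; apply: eq_bigr => l _.
  rewrite -{1}(fineK (Tfin l)) sumEFin sumr_const card_prod card_ord.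
  by rewrite -[fine _ *+ _]mulr_natr natrM -expr2.
rewrite S_eq !lee_fin in AS SB.
by rewrite ler_pdivrMr ?ler_pdivlMr ?exprn_gt0 ?ltr0n// AS SB.
Qed.
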